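(* Let $\mathcal{L}$ be a finite trim lattice with left modular labelling $\gamma$ and Galois graph $G(\mathcal{L})$ on $[n]$. For distinct $a,b\in[n]$, there exists $x\in\mathcal{L}$ with $\mathrm{D}^\gamma(x)=\{a,b\}$ if and only if $G(\mathcal{L})$ has neither an arrow $a\to b$ nor an arrow $b\to a$. That is, the $1$-skeleton of the complex $\{\mathrm{D}^\gamma(x): x\in\mathcal{L}\}$ is the complement of the underlying undirected graph of $G(\mathcal{L})$.
   Context: A finite lattice of length $n$ is extremal if it has exactly $n$ join-irreducible and $n$ meet-irreducible elements; an element $x$ is left modular if $(y\vee x)\wedge z=y\vee(x\wedge z)$ for all $y\le z$; the lattice is trim if it is extremal and has a maximal chain of left modular elements. Fix a chain $\hat0=x_0\lessdot\dots\lessdot x_n=\hat1$ of left modular elements of length $n$; $j_i$ is the unique join-irreducible with $j_i\le x_i$, $j_i\not\le x_{i-1}$, and $m_i$ the unique meet-irreducible with $m_i\ge x_{i-1}$, $m_i\not\ge x_i$. The left modular labelling is $\gamma(y\lessdot z)=\min\{i\in[n]: y\vee(x_i\wedge z)=z\}$, and $\mathrm{D}^\gamma(y)=\{\gamma(x\lessdot y): x\lessdot y\}$. The Galois graph $G(\mathcal{L})$ is the directed graph on $[n]$ with an arrow $i\to k$ iff $i\ne k$ and $j_i\not\le m_k$. *)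

(* Defs.v *)
From HB Require Import structures.
From mathcomp Require Import all_boot all_order.

Set Implicit Arguments.
Unset Strict Implicit.
Unset Printing Implicit Defensive.

Import Order.TTheory.
Local Open Scope order_scope.

Definition covered_by (d : Order.disp_t) (L : finTBLatticeType d) (y z : L) :
    bool :=
  (y < z) && [forall t : L, ~~ ((y < t) && (t < z))].

Definition join_irreducible (d : Order.disp_t) (L : finTBLatticeType d)
    (j : L) : bool :=
  (j != \bot) &&
  [forall y : L, forall z : L, (y `|` z == j) ==> (y == j) || (z == j)].

Definition meet_irreducible (d : Order.disp_t) (L : finTBLatticeType d)
    (m : L) : bool :=
  (m != \top) &&
  [forall y : L, forall z : L, (y `&` z == m) ==> (y == m) || (z == m)].

Definition is_chain (d : Order.disp_t) (L : finTBLatticeType d)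
    (C : {set L}) : bool :=
  [forall y in C, forall z in C, y >=< z].

(* A chain of k + 1 elements has length k. *)
Definition lattice_length (d : Order.disp_t) (L : finTBLatticeType d) : nat :=
  \max_(C : {set L} | is_chain C) #|C|.-1.

Definition extremal (d : Order.disp_t) (L : finTBLatticeType d) : Prop :=
  #|[set j : L | join_irreducible j]| = lattice_length L /\
  #|[set m : L | meet_irreducible m]| = lattice_length L.

Definition left_modular (d : Order.disp_t) (L : finTBLatticeType d) (x : L) :
    Prop :=
  forall y z : L, y <= z -> (y `|` x) `&` z = y `|` (x `&` z).

(* Ordinals count from 0: [i : 'I_n] stands for the index i + 1 of {1, ..., n},
   so [chain_lower x i] is x_i and [chain_upper x i] is x_(i+1). *)
Definition chain_lower (d : Order.disp_t) (L : finTBLatticeType d) (n : nat)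
    (x : 'I_n.+1 -> L) (i : 'I_n) : L := x (widen_ord (leqnSn n) i).

Definition chain_upper (d : Order.disp_t) (L : finTBLatticeType d) (n : nat)
    (x : 'I_n.+1 -> L) (i : 'I_n) : L := x (lift ord0 i).

Definition left_modular_maximal_chain (d : Order.disp_t)
    (L : finTBLatticeType d) (n : nat) (x : 'I_n.+1 -> L) : Prop :=
  [/\ x ord0 = \bot, x ord_max = \top,
      forall i : 'I_n, covered_by (chain_lower x i) (chain_upper x i)
    & forall i : 'I_n.+1, left_modular (x i)].

Definition trim (d : Order.disp_t) (L : finTBLatticeType d) : Prop :=
  extremal L /\
  exists (k : nat) (c : 'I_k.+1 -> L), left_modular_maximal_chain c.

(* The default values of [chain_join_irr] and [chain_meet_irr] are never used
   when L is extremal of length n and x is a maximal chain of length n: by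
   counting, exactly one element then satisfies each condition. *)
Definition chain_join_irr (d : Order.disp_t) (L : finTBLatticeType d) (n : nat)
    (x : 'I_n.+1 -> L) (i : 'I_n) : L :=
  odflt \bot [pick j : L | [&& join_irreducible j, j <= chain_upper x i
                             & ~~ (j <= chain_lower x i)]].

Definition chain_meet_irr (d : Order.disp_t) (L : finTBLatticeType d) (n : nat)
    (x : 'I_n.+1 -> L) (i : 'I_n) : L :=
  odflt \top [pick m : L | [&& meet_irreducible m, chain_lower x i <= m
                             & ~~ (chain_upper x i <= m)]].

Definition galois_arrow (d : Order.disp_t) (L : finTBLatticeType d) (n : nat)
    (x : 'I_n.+1 -> L) : rel 'I_n :=
  [rel i k | (i != k) && ~~ (chain_join_irr x i <= chain_meet_irr x k)].

(* The minimum of {i | y \/ (x_i /\ z) = z}, as an option so that n = 0 is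
   allowed; it is never [None] when y is covered by z, since x_n = \top. *)
Definition left_modular_label (d : Order.disp_t) (L : finTBLatticeType d)
    (n : nat) (x : 'I_n.+1 -> L) (y z : L) : option 'I_n :=
  let P := [pred i : 'I_n | y `|` (chain_upper x i `&` z) == z] in
  [pick i : 'I_n | P i && [forall k : 'I_n, P k ==> (i <= k)%N]].

Definition down_labels (d : Order.disp_t) (L : finTBLatticeType d) (n : nat)
    (x : 'I_n.+1 -> L) (y : L) : {set 'I_n} :=
  [set i : 'I_n | [exists z : L, covered_by z y &&
                     (left_modular_label x z y == Some i)]].

Definition down_label_complex (d : Order.disp_t) (L : finTBLatticeType d)
    (n : nat) (x : 'I_n.+1 -> L) : {set {set 'I_n}} :=
  [set down_labels x y | y : L].

Definition one_skeleton (V : finType) (K : {set {set V}}) : {set {set V}} :=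
  [set F in K | (#|F| <= 2)%N].

(* A graph on V as a simplicial complex: the empty face, all vertices and
   all edges. *)
Definition graph_complex (V : finType) (e : rel V) : {set {set V}} :=
  [set F : {set V} | (#|F| <= 2)%N &
     [forall a in F, forall b in F, (a != b) ==> e a b]].

Definition underlying_undirected (V : finType) (e : rel V) : rel V :=
  [rel a b | e a b || e b a].

Definition graph_complement (V : finType) (e : rel V) : rel V :=
  [rel a b | (a != b) && ~~ e a b].

(* Main.v *)
Require Import Defs.
From HB Require Import structures.
From mathcomp Require Import all_boot all_order.

(** A cover y <. z has label i iff x_{i-1} /\ z <= y and z <= y \/ x_i; then
    m_i >= y, so m_i is not above z. Two labels a < b of z are non-adjacent by
    looking at the largest label of the interval [y_a /\ y_b, z]. Conversely, for
    a <= b non-adjacent, put z = j_a \/ j_b: lower covers of z above z /\ m_a and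
    above z /\ m_b are labelled a and b, and by the first part a further label l would have
    m_l >= j_a and m_l >= j_b, hence m_l >= z. The case a = b gives the vertices. *)

Set Implicit Arguments.
Unset Strict Implicit.
Unset Printing Implicit Defensive.

Import Order.TTheory.
Local Open Scope order_scope.

(** * Irreducible elements and covers in a finite lattice *)

Lemma exists_join_irreducible (d : Order.disp_t) (L : finTBLatticeType d)
    (u v : L) :
  ~~ (u <= v) -> exists j : L, [/\ join_irreducible j, j <= u & ~~ (j <= v)].
Proof.
have [k] := ubnP #|[set t : L | t <= u]|.
elim: k u => // k IH u; rewrite ltnS => ltk nuv.
have below (w : L) : w < u -> (#|[set t : L | (t <= w)%O]| < k)%N.
  move=> ltwu; apply: leq_trans ltk; apply: proper_card; apply/properP; split.
    by apply/subsetP => t; rewrite !inE => /le_trans; apply; exact: ltW.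
  by exists u; rewrite !inE ?lexx ?lt_geF.
have [ju|] := boolP (join_irreducible u); first by exists u.
rewrite negb_and negbK => /orP[/eqP u0|]; first by rewrite u0 le0x in nuv.
(* A reducible [u] is a join of two strictly smaller elements, and at least one of them is not below
   [v]. *)
rewrite negb_forall => /existsP[y]; rewrite negb_forall => /existsP[z].
rewrite negb_imply negb_or => /and3P[/eqP yz yu zu].
have ltyu : y < u by rewrite lt_neqAle yu -yz leUl.
have ltzu : z < u by rewrite lt_neqAle zu -yz leUr.
have [yv|nyv] := boolP (y <= v).
  have nzv : ~~ (z <= v) by apply: contra nuv => zv; rewrite -yz leUx yv.
  have [j [jj jz jv]] := IH z (below _ ltzu) nzv.
  by exists j; split=> //; apply: le_trans jz (ltW ltzu).
have [j [jj jy jv]] := IH y (below _ ltyu) nyv.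
by exists j; split=> //; apply: le_trans jy (ltW ltyu).
Qed.

Lemma exists_meet_irreducible (d : Order.disp_t) (L : finTBLatticeType d)
    (u v : L) :
  ~~ (u <= v) -> exists m : L, [/\ meet_irreducible m, v <= m & ~~ (u <= m)].
(* Passing to [L^d] exchanges joins with meets by conversion and swaps the roles of [u] and [v]. *)
Proof. exact: (@exists_join_irreducible _ L^d v u). Qed.

Lemma exists_lower_cover (d : Order.disp_t) (L : finTBLatticeType d)
    (t z : L) :
  t < z -> exists2 y : L, t <= y & covered_by y z.
Proof.
have [k] := ubnP #|[set s : L | t < s]|.
elim: k t => // k IH t; rewrite ltnS => ltk ltz.
have [cov|] := boolP (covered_by t z); first by exists t.
rewrite negb_and ltz /= negb_forall => /existsP[s]; rewrite negbK => /andP[ts sz].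
have [|y sy cov] := IH s _ sz.
  apply: leq_trans ltk; apply: proper_card; apply/properP; split.
    by apply/subsetP => r; rewrite !inE; apply: lt_trans.
  by exists s; rewrite !inE ?ltxx.
by exists y => //; apply: le_trans sy; exact: ltW.
Qed.

Lemma covered_by_eq (d : Order.disp_t) (L : finTBLatticeType d) (y z t : L) :
  covered_by y z -> y <= t -> t <= z -> ~~ (z <= t) -> t = y.
Proof.
move=> /andP[_ /forallP/(_ t)]; rewrite !lt_neqAle => cov yt tz nzt.
move: cov; rewrite yt tz !andbT negb_and !negbK => /orP[/eqP //|/eqP tz'].
by rewrite tz' lexx in nzt.
Qed.

(** Choosing one element of [S] per class is injective because the classes are disjoint, hence onto
    [S] by cardinality. This is how extremality yields uniqueness of j_i and m_i. *)
Lemma unique_representative (T : finType) (n : nat) (S : {set T})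
    (P : 'I_n -> pred T) :
  #|S| = n -> (forall i, exists2 t, t \in S & P i t) ->
  (forall i k t, P i t -> P k t -> i = k) ->
  forall i s t, s \in S -> t \in S -> P i s -> P i t -> s = t.
Proof.
move=> cardS exP disj.
have exP' i : exists t, (t \in S) && P i t.
  by have [t tS Pt] := exP i; exists t; rewrite tS.
pose f i := xchoose (exP' i).
have fP i : (f i \in S) /\ P i (f i) by apply/andP; exact: (xchooseP (exP' i)).
have f_inj : injective f.
  move=> i k eqf; have [_ Pi] := fP i; have [_ Pk] := fP k.
  by apply: disj Pi _; rewrite eqf.
have codf : f @: setT = S.
  apply/eqP; rewrite eqEcard card_imset // cardsT card_ord cardS leqnn andbT.
  by apply/subsetP => _ /imsetP[i _ ->]; have [] := fP i.
move=> i s t; rewrite -codf => /imsetP[k _ ->] /imsetP[l _ ->] Pk Pl.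
have [_ Pfk] := fP k; have [_ Pfl] := fP l.
by rewrite -(disj _ _ _ Pk Pfk) -(disj _ _ _ Pl Pfl).
Qed.

(** * The left modular chain and its irreducibles j_i and m_i *)

Lemma chain_le (d : Order.disp_t) (L : finTBLatticeType d) (n : nat)
    (x : 'I_n.+1 -> L) :
  left_modular_maximal_chain x -> forall i k : 'I_n.+1, (i <= k)%N -> x i <= x k.
Proof.
move=> [_ _ cov _] i [k hk] /=; elim: k hk => [|k IH] hk.
  by rewrite leqn0 => /eqP i0; have -> : i = Ordinal hk by exact: val_inj.
rewrite leq_eqVlt => /orP[/eqP ik|].
  by have -> : i = Ordinal hk by exact: val_inj.
rewrite ltnS => /(IH (ltnW hk)) /le_trans; apply.
have /andP[/ltW + _] := cov (Ordinal (hk : (k < n)%N)).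
congr (x _ <= x _); exact: val_inj.
Qed.

Lemma chain_upper_le_lower (d : Order.disp_t) (L : finTBLatticeType d) (n : nat)
    (x : 'I_n.+1 -> L) (i k : 'I_n) :
  left_modular_maximal_chain x -> (i < k)%N -> chain_upper x i <= chain_lower x k.
Proof. by move=> Hx ik; apply: (chain_le Hx); rewrite /= /bump. Qed.

Lemma chain_lower_le_upper (d : Order.disp_t) (L : finTBLatticeType d) (n : nat)
    (x : 'I_n.+1 -> L) (i : 'I_n) :
  left_modular_maximal_chain x -> chain_lower x i <= chain_upper x i.
Proof. by move=> [_ _ /(_ i)/andP[/ltW]]. Qed.

(** An upward closed predicate switches from false to true at most once along a chain. *)
Lemma chain_level_inj (d : Order.disp_t) (L : finTBLatticeType d) (n : nat)
    (x : 'I_n.+1 -> L) (Q : pred L) (i k : 'I_n) :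
  left_modular_maximal_chain x ->
  (forall s t : L, s <= t -> Q s -> Q t) ->
  Q (chain_upper x i) -> ~~ Q (chain_lower x i) ->
  Q (chain_upper x k) -> ~~ Q (chain_lower x k) -> i = k.
Proof.
move=> Hx monQ Qi Ni Qk Nk; apply: val_inj; case: (ltngtP i k) => // lt.
  by case/negP: Nk; apply: monQ Qi; exact: chain_upper_le_lower.
by case/negP: Ni; apply: monQ Qk; exact: chain_upper_le_lower.
Qed.

Lemma chain_level_exists (d : Order.disp_t) (L : finTBLatticeType d) (n : nat)
    (x : 'I_n.+1 -> L) (Q : pred L) :
  left_modular_maximal_chain x -> ~~ Q \bot -> Q \top ->
  exists i : 'I_n, Q (chain_upper x i) /\ ~~ Q (chain_lower x i).
Proof.
move=> [x0 xn _ _] Q0 Q1.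
case: (@arg_minnP _ ord_max (fun i => Q (x i)) val); first by rewrite xn.
(* The least index satisfying [Q] is not 0, as [Q] fails at the bottom; so it is the upper end of a
   step [k], and by minimality [Q] fails at the lower end. *)
move=> i Qi mini; case: (unliftP ord0 i) => [k ik|i0]; last by rewrite i0 x0 (negPf Q0) in Qi.
exists k; rewrite /chain_upper -ik; split=> //; apply/negP => /mini.
by rewrite ik /= /bump add1n ltnn.
Qed.

(** The default [\bot] is never reached: x_i is not below x_{i-1}, so some join-irreducible
    separates them. *)
Lemma chain_join_irrP (d : Order.disp_t) (L : finTBLatticeType d) (n : nat)
    (x : 'I_n.+1 -> L) (i : 'I_n) :
  left_modular_maximal_chain x ->
  [/\ join_irreducible (chain_join_irr x i), chain_join_irr x i <= chain_upper x i
    & ~~ (chain_join_irr x i <= chain_lower x i)].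
Proof.
move=> Hx; rewrite /chain_join_irr; case: pickP => [j /and3P //|no].
have [_ _ /(_ i)/andP[/lt_geF/negbT/exists_join_irreducible[j [jj ju jl]]] _ _] := Hx.
by have := no j; rewrite jj ju jl.
Qed.

Lemma chain_meet_irrP (d : Order.disp_t) (L : finTBLatticeType d) (n : nat)
    (x : 'I_n.+1 -> L) (i : 'I_n) :
  left_modular_maximal_chain x ->
  [/\ meet_irreducible (chain_meet_irr x i), chain_lower x i <= chain_meet_irr x i
    & ~~ (chain_upper x i <= chain_meet_irr x i)].
Proof.
move=> Hx; rewrite /chain_meet_irr; case: pickP => [m /and3P //|no].
have [_ _ /(_ i)/andP[/lt_geF/negbT/exists_meet_irreducible[m [mm ml mu]]] _ _] := Hx.
by have := no m; rewrite mm ml mu.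
Qed.

Lemma chain_join_irr_unique (d : Order.disp_t) (L : finTBLatticeType d) (n : nat)
    (x : 'I_n.+1 -> L) (i : 'I_n) (j : L) :
  #|[set j : L | join_irreducible j]| = n -> left_modular_maximal_chain x ->
  join_irreducible j -> j <= chain_upper x i -> ~~ (j <= chain_lower x i) ->
  j = chain_join_irr x i.
Proof.
move=> card Hx jj ju jl; have [cj cu cl] := chain_join_irrP i Hx.
pose P (i : 'I_n) := [pred j : L | (j <= chain_upper x i) && ~~ (j <= chain_lower x i)].
apply: (@unique_representative _ _ _ P card _ _ i); rewrite ?inE //= ?ju ?cu //.
  move=> k; exists (chain_join_irr x k); have [ck cku ckl] := chain_join_irrP k Hx.
    by rewrite inE.
  by rewrite /= cku.
move=> k l t /= /andP[ku kl] /andP[lu ll].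
by apply: (chain_level_inj (Q := fun s => t <= s) Hx) => // r s rs /le_trans; apply.
Qed.

Lemma chain_meet_irr_unique (d : Order.disp_t) (L : finTBLatticeType d) (n : nat)
    (x : 'I_n.+1 -> L) (i : 'I_n) (m : L) :
  #|[set m : L | meet_irreducible m]| = n -> left_modular_maximal_chain x ->
  meet_irreducible m -> chain_lower x i <= m -> ~~ (chain_upper x i <= m) ->
  m = chain_meet_irr x i.
Proof.
move=> card Hx mm ml mu; have [cm cl cu] := chain_meet_irrP i Hx.
pose P (i : 'I_n) := [pred m : L | (chain_lower x i <= m) && ~~ (chain_upper x i <= m)].
apply: (@unique_representative _ _ _ P card _ _ i); rewrite ?inE //= ?ml ?cl //.
  move=> k; exists (chain_meet_irr x k); have [ck ckl cku] := chain_meet_irrP k Hx.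
    by rewrite inE.
  by rewrite /= ckl.
move=> k l t /= /andP[kl ku] /andP[ll lu].
(* Not being below [t] is the upward closed condition, dual to being above a join-irreducible. *)
apply: (chain_level_inj (Q := fun s => ~~ (s <= t)) Hx) => //; rewrite ?negbK //.
by move=> r s rs; apply: contra; apply: le_trans.
Qed.

Lemma chain_join_irr_le_meet_irr (d : Order.disp_t) (L : finTBLatticeType d)
    (n : nat) (x : 'I_n.+1 -> L) (i k : 'I_n) :
  left_modular_maximal_chain x -> (i < k)%N ->
  chain_join_irr x i <= chain_meet_irr x k.
Proof.
move=> Hx ik; have [_ ju _] := chain_join_irrP i Hx.
have [_ ml _] := chain_meet_irrP k Hx.
by apply: le_trans ju (le_trans (chain_upper_le_lower Hx ik) ml).
Qed.

(** Since x_{i-1} is covered by x_i, x_{i-1} \/ j_i = x_i; if j_i were below m_i, then x_i would be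
    too. *)
Lemma chain_join_irr_nle_meet_irr (d : Order.disp_t) (L : finTBLatticeType d)
    (n : nat) (x : 'I_n.+1 -> L) (i : 'I_n) :
  left_modular_maximal_chain x -> ~~ (chain_join_irr x i <= chain_meet_irr x i).
Proof.
move=> Hx; have [_ ju jl] := chain_join_irrP i Hx.
have [_ ml mu] := chain_meet_irrP i Hx; have [_ _ /(_ i) cov _] := Hx.
apply: contra mu => jm; set u := chain_upper x i.
have [ul|nul] := boolP (u <= chain_lower x i `|` chain_join_irr x i).
  by apply: le_trans ul _; rewrite leUx ml.
case/negP: jl; rewrite -[leRHS](covered_by_eq cov _ _ nul) ?leUl ?leUr //.
by rewrite leUx ju (chain_lower_le_upper _ Hx).
Qed.

(** * Labels of covers *)

Lemma left_modular_labelP (d : Order.disp_t) (L : finTBLatticeType d) (n : nat)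
    (x : 'I_n.+1 -> L) (y z : L) (i : 'I_n) :
  left_modular_maximal_chain x -> covered_by y z ->
  left_modular_label x y z = Some i <->
  chain_lower x i `&` z <= y /\ z <= y `|` chain_upper x i.
Proof.
move=> Hx cov; have [x0 x1 _ lm] := Hx; have /andP[ltyz _] := cov.
have leyz := ltW ltyz.
(* [Q] is upward closed, so the label is the unique level at which it becomes true. Left modularity
   simplifies [Q] at the upper end; the cover turns its failure at the lower end into x_{i-1} /\ z
   <= y. *)
pose Q t := z <= y `|` (t `&` z).
have monQ s t : s <= t -> Q s -> Q t.
  by move=> st /le_trans; apply; rewrite leU2 // leI2.
have QP k : (y `|` (chain_upper x k `&` z) == z) = Q (chain_upper x k).
  by rewrite eq_le leUx leyz leIr.
have QuE k : Q (chain_upper x k) = (z <= y `|` chain_upper x k).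
  by rewrite /Q -lm // lexI lexx andbT.
have QlE k : ~~ Q (chain_lower x k) = (chain_lower x k `&` z <= y).
  apply/idP/idP => [nQ|le].
    by rewrite -[leRHS](covered_by_eq cov _ _ nQ) ?leUl ?leUr // leUx leyz leIr.
  by rewrite /Q (join_l le) lt_geF.
rewrite -QlE -QuE /left_modular_label.
have [| |k [Qk Nk]] := @chain_level_exists _ _ _ x Q Hx.
- by rewrite /Q meet0x joinx0 lt_geF.
- by rewrite /Q meet1x leUr.
case: pickP => [l|/(_ k)] /=; last first.
  rewrite QP Qk /= => /negbT/forallPn[l]; rewrite QP negb_imply -ltnNge => /andP[Ql lk].
  by case/negP: Nk; apply: monQ Ql; exact: chain_upper_le_lower.
rewrite QP => /andP[Ql /forallP minl].
have Nl : ~~ Q (chain_lower x l).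
  have lk : (l <= k)%N by have := minl k; rewrite QP Qk.
  by apply: contra Nk; apply: monQ; apply: (chain_le Hx).
split=> [[<-] //|[Ni Qi]]; congr Some; exact: (chain_level_inj Hx monQ).
Qed.

Lemma in_down_labelsP (d : Order.disp_t) (L : finTBLatticeType d) (n : nat)
    (x : 'I_n.+1 -> L) (z : L) (i : 'I_n) :
  left_modular_maximal_chain x ->
  reflect (exists y : L, [/\ covered_by y z, chain_lower x i `&` z <= y
                           & z <= y `|` chain_upper x i])
          (i \in down_labels x z).
Proof.
move=> Hx; rewrite inE; apply: (iffP existsP) => [[y /andP[cov /eqP]]|[y [cov l u]]].
  by move/(left_modular_labelP _ Hx cov) => [l u]; exists y.
by exists y; rewrite cov; apply/eqP/(left_modular_labelP _ Hx cov).
Qed.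

(** By left modularity [z] is not below y \/ x_{i-1}. A meet-irreducible above y \/ x_{i-1} but not
    above [z] cannot be above x_i, because z <= y \/ x_i; uniqueness makes it m_i. *)
Lemma lower_cover_le_meet_irr (d : Order.disp_t) (L : finTBLatticeType d)
    (n : nat) (x : 'I_n.+1 -> L) (y z : L) (i : 'I_n) :
  #|[set m : L | meet_irreducible m]| = n -> left_modular_maximal_chain x ->
  covered_by y z -> chain_lower x i `&` z <= y -> z <= y `|` chain_upper x i ->
  y <= chain_meet_irr x i /\ ~~ (z <= chain_meet_irr x i).
Proof.
move=> card Hx cov l u; have /andP[ltyz _] := cov; have [_ _ _ lm] := Hx.
have nz : ~~ (z <= y `|` chain_lower x i).
  apply/negP => le; have /eqP := lm (widen_ord (leqnSn n) i) _ _ (ltW ltyz).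
  by rewrite (meet_r le) (join_l l) eq_sym (lt_eqF ltyz).
have [m [mm + zm]] := exists_meet_irreducible nz; rewrite leUx => /andP[ym lm'].
rewrite -(chain_meet_irr_unique card Hx mm lm') //.
by apply: contra zm => um; apply: le_trans u _; rewrite leUx ym.
Qed.

(** * Down labels and arrows of the Galois graph *)

Lemma down_labels_le (d : Order.disp_t) (L : finTBLatticeType d) (n : nat)
    (x : 'I_n.+1 -> L) (y z : L) (i k : 'I_n) :
  left_modular_maximal_chain x -> covered_by y z ->
  chain_lower x i `&` z <= y -> z <= y `|` chain_upper x k -> (i <= k)%N.
Proof.
move=> Hx cov l u; have /andP[ltyz _] := cov; have [_ _ _ lm] := Hx.
rewrite leqNgt; apply/negP => ki.
(* If k < i, then x_k /\ z <= x_{i-1} /\ z <= y, and left modularity of x_k collapses [z] to [y]. *)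
have /eqP := lm (lift ord0 k) _ _ (ltW ltyz); rewrite (meet_r u) (join_l _) ?gt_eqF //.
by apply: le_trans l; rewrite leI2 // (chain_upper_le_lower Hx ki).
Qed.

(* M is the largest label of the interval [w, z]; every lower cover of z above w
   with another label lies above j_M, but j_M is not below w. *)
Lemma down_labels_no_arrow (d : Order.disp_t) (L : finTBLatticeType d) (n : nat)
    (x : 'I_n.+1 -> L) (z : L) (a b : 'I_n) :
  #|[set j : L | join_irreducible j]| = n ->
  #|[set m : L | meet_irreducible m]| = n -> left_modular_maximal_chain x ->
  a \in down_labels x z -> b \in down_labels x z -> (a < b)%N ->
  chain_join_irr x b <= chain_meet_irr x a.
Proof.
move=> cardj cardm Hx /(in_down_labelsP _ _ Hx)[ya [cova la ua]].
move=> /(in_down_labelsP _ _ Hx)[yb [covb lb ub]] ab.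
pose w := ya `&` yb.
have /andP[ltya _] := cova; have /andP[ltyb _] := covb; have [_ _ _ lm] := Hx.
have ltwz : w < z by apply: le_lt_trans ltya; exact: leIl.
(* [M] is the level at which w \/ x_M first reaches above [z]. *)
have [||M [zM zNM]] := @chain_level_exists _ _ _ x (fun t => z <= w `|` t) Hx.
- by rewrite joinx0 lt_geF.
- by rewrite joinx1 lex1.
have join_irr_le y (i : 'I_n) : w <= y -> y <= z -> z <= y `|` chain_upper x i ->
    (i < M)%N -> chain_join_irr x M <= y /\ ~~ (chain_join_irr x M <= w).
  move=> wy yz u iM.
  have eqy : w `|` (chain_upper x M `&` y) = y.
    by rewrite -lm // meet_r // (le_trans yz).
  (* Otherwise y <= w \/ x_{M-1}; as x_i <= x_{M-1}, this would put [z] below w \/ x_{M-1}. A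
     join-irreducible witnessing the failure lies at level [M], so it is j_M. *)
  have : ~~ (chain_upper x M `&` y <= w `|` chain_lower x M).
    apply: contra zNM => le; apply: le_trans u _.
    rewrite leUx -{1}eqy leUx leUl le /=.
    by apply: le_trans (chain_upper_le_lower Hx iM) _; exact: leUr.
  move=> /exists_join_irreducible[j [jj]]; rewrite lexI => /andP[jM jy] jN.
  rewrite -(chain_join_irr_unique cardj Hx jj jM).
    by split=> //; apply: contra jN => /le_trans; apply; exact: leUl.
  by apply: contra jN => /le_trans; apply; exact: leUr.
have bM : (b <= M)%N.
  by apply: (down_labels_le Hx covb lb); apply: le_trans zM _; rewrite leU2 ?leIr.
have [jya jw] := join_irr_le ya a (leIl _ _) (ltW ltya) ua (leq_trans ab bM).
have [yam _] := lower_cover_le_meet_irr cardm Hx cova la ua.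
(* If b = M, then j_b <= y_a <= m_a. If b < M, then j_M lies below both y_a and y_b, hence below
   [w], a contradiction. *)
move: bM; rewrite leq_eqVlt => /orP[/eqP/val_inj ->|bM]; first exact: le_trans jya yam.
have [jyb _] := join_irr_le yb b (leIr _ _) (ltW ltyb) ub bM.
by rewrite lexI jya jyb in jw.
Qed.

(** Arrows never go from a smaller to a larger index, so only the direction from the larger label to
    the smaller one is at stake. *)
Lemma galois_arrow_down_labels (d : Order.disp_t) (L : finTBLatticeType d)
    (n : nat) (x : 'I_n.+1 -> L) (z : L) (a b : 'I_n) :
  #|[set j : L | join_irreducible j]| = n ->
  #|[set m : L | meet_irreducible m]| = n -> left_modular_maximal_chain x ->
  a \in down_labels x z -> b \in down_labels x z -> ~~ galois_arrow x a b.
Proof.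
move=> cardj cardm Hx az bz; rewrite /galois_arrow /= negb_and negbK.
case: (ltngtP a b) => [ab|ba|/val_inj ->]; last by rewrite eqxx.
  by rewrite (chain_join_irr_le_meet_irr Hx ab) orbT.
by rewrite (down_labels_no_arrow cardj cardm Hx bz az ba) orbT.
Qed.

Lemma down_labels_join (d : Order.disp_t) (L : finTBLatticeType d)
    (n : nat) (x : 'I_n.+1 -> L) (a b : 'I_n) :
  #|[set j : L | join_irreducible j]| = n ->
  #|[set m : L | meet_irreducible m]| = n -> left_modular_maximal_chain x ->
  ~~ galois_arrow x a b -> ~~ galois_arrow x b a ->
  down_labels x (chain_join_irr x a `|` chain_join_irr x b) = [set a; b].
Proof.
move=> cardj cardm Hx.
wlog ab : a b / (a <= b)%N => [wl|] Nab Nba.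
  by case: (leqP a b) => [/wl|/ltnW/wl]; last rewrite joinC setUC; apply.
set z := _ `|` _; have [_ jau _] := chain_join_irrP a Hx.
have [_ jbu _] := chain_join_irrP b Hx.
(* The element [t] witnesses that [z] is not below m_i, so [z] has a lower cover above z /\ m_i, and
   it contains x_{i-1} /\ z because x_{i-1} <= m_i. *)
have label_mem (i : 'I_n) (t : L) : t <= z -> ~~ (t <= chain_meet_irr x i) ->
    (forall y, z `&` chain_meet_irr x i <= y -> z <= y `|` chain_upper x i) ->
    i \in down_labels x z.
  move=> tz tm zu.
  have lt : z `&` chain_meet_irr x i < z.
    rewrite lt_neqAle leIl andbT; apply: contra tm => /eqP eqz.
    by apply: le_trans tz _; rewrite -eqz leIr.
  have [y mey cov] := exists_lower_cover lt; apply/(in_down_labelsP _ _ Hx).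
  exists y; split=> //; last exact: zu.
  by apply: le_trans mey; rewrite meetC leI2 //; case: (chain_meet_irrP i Hx).
have bz : b \in down_labels x z.
  apply: (label_mem _ (chain_join_irr x b)); rewrite ?leUr //.
    exact: chain_join_irr_nle_meet_irr.
  (* As a <= b, both j_a and j_b lie below x_b, so z <= x_b. *)
  move=> y _; apply: le_trans (leUr _ _); rewrite leUx jbu andbT.
  by apply: le_trans jau _; apply: (chain_le Hx); rewrite /= /bump !add1n ltnS.
have az : a \in down_labels x z.
  have [-> //|neab] := eqVneq a b.
  apply: (label_mem _ (chain_join_irr x a)); rewrite ?leUl //.
    exact: chain_join_irr_nle_meet_irr.
  (* Here j_a <= x_a, while j_b <= m_a since there is no arrow from [b] to [a]; thus j_b <= z /\ m_a
     <= y. *)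
  move=> y /(le_trans _) mey; rewrite leUx (le_trans jau) ?leUr //=.
  apply: le_trans (leUl _ _); apply: mey; rewrite lexI leUr /=.
  by move: Nba; rewrite /galois_arrow /= eq_sym neab /= negbK.
apply/setP => l; rewrite !inE; apply/idP/idP => [lz|]; last first.
  by case/orP=> /eqP ->; [move: az|move: bz]; rewrite inE.
have {}lz : l \in down_labels x z by rewrite inE.
have := galois_arrow_down_labels cardj cardm Hx az lz.
have := galois_arrow_down_labels cardj cardm Hx bz lz.
rewrite /galois_arrow /= ![_ == l]eq_sym !negb_and !negbK.
have [//|_ /=] := eqVneq l a; have [//|_ /= jb ja] := eqVneq l b.
have [y [cov ly uy]] := in_down_labelsP _ _ Hx lz.
have [_] := lower_cover_le_meet_irr cardm Hx cov ly uy.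
by rewrite leUx ja jb.
Qed.

(** * Faces with at most two vertices *)

Lemma down_labels_bot (d : Order.disp_t) (L : finTBLatticeType d) (n : nat)
    (x : 'I_n.+1 -> L) : down_labels x \bot = set0.
Proof.
by apply/setP => i; rewrite !inE; apply/existsP => -[y /andP[/andP[]]]; rewrite ltx0.
Qed.

Theorem theorem5p5 (d : Order.disp_t) (L : finTBLatticeType d) (n : nat)
    (Hlen : lattice_length L = n) (Htrim : trim L)
    (x : 'I_n.+1 -> L) (Hx : left_modular_maximal_chain x) :
  (forall a b : 'I_n, a <> b ->
     ((exists y : L, down_labels x y = [set a; b]) <->
      (~ galois_arrow x a b /\ ~ galois_arrow x b a))) /\
  one_skeleton (down_label_complex x) =
    graph_complex (graph_complement (underlying_undirected (galois_arrow x))).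
Proof.
have [[cardj cardm] _] := Htrim; rewrite Hlen in cardj cardm.
have no_arrow := galois_arrow_down_labels cardj cardm Hx.
have join_labels := down_labels_join cardj cardm Hx.
split=> [a b _|].
  split=> [[y Dy]|[/negP Nab /negP Nba]]; last by eexists; exact: join_labels.
  by split; apply/negP; apply: (no_arrow y); rewrite Dy !inE eqxx ?orbT.
apply/setP => F; rewrite [LHS]inE [RHS]inE andbC; apply: andb_id2l => cardF.
apply/idP/idP => [/imsetP[y _ ->]|indF].
  apply/forall_inP => a az; apply/forall_inP => b bz; apply/implyP => ab.
  by rewrite /graph_complement /underlying_undirected [X in is_true X]/= ab negb_or
     (no_arrow y a b) // (no_arrow y b a).
(* The case a = b is included, because the arrow relation is irreflexive; it serves the singleton
   faces. *)
have indep a b : a \in F -> b \in F -> ~~ galois_arrow x a b.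
  move=> aF bF; have [->|ab] := eqVneq a b; first by rewrite /galois_arrow /= eqxx.
  have /forall_inP/(_ a aF)/forall_inP/(_ b bF)/implyP/(_ ab) := indF.
  by case/andP=> _; rewrite negb_or => /andP[].
have pair (a b : 'I_n) : F = [set a; b] -> F \in down_label_complex x.
  move=> FE; have aF : a \in F by rewrite FE !inE eqxx.
  have bF : b \in F by rewrite FE !inE eqxx orbT.
  by rewrite FE -(join_labels a b) ?imset_f ?indep.
move: cardF; rewrite leq_eqVlt => /orP[/cards2P[a [b [_ FE]]]|].
  exact: pair FE.
rewrite ltnS leq_eqVlt => /orP[/cards1P[a FE]|].
  by apply: (pair a a); rewrite setUid.
(* The empty face comes from the bottom element, which has no lower covers. *)
rewrite ltnS leqn0 cards_eq0 => /eqP ->; rewrite -(down_labels_bot x).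
exact: imset_f.
Qed.
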